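(* Let $\mathcal{I}$ be an ideal on $\omega$. Then $c$ is complemented in $c(\mathcal{I})\cap\ell_\infty$ if and only if $\mathcal{I}=\mathrm{Fin}$.
   Context: An ideal on $\omega$ is a family $\mathcal{I}\subseteq\mathcal{P}(\omega)$ closed under subsets and finite unions; it is also assumed that $\mathrm{Fin}\subseteq\mathcal{I}$ and $\omega\notin\mathcal{I}$, where $\mathrm{Fin}$ is the family of all finite subsets of $\omega$. A real sequence $(x_n)_{n\in\omega}$ is $\mathcal{I}$-convergent to $y\in\mathbb{R}$ if $\{n: x_n\notin U\}\in\mathcal{I}$ for every neighborhood $U$ of $y$. $c(\mathcal{I})$ is the space of real sequences that are $\mathcal{I}$-convergent (to some real number), and $c$ is the space of convergent real sequences. $\ell_\infty$ is the Banach space of bounded real sequences indexed by $\omega$ with the sup norm; $c$ and $c(\mathcal{I})\cap\ell_\infty$ carry the sup norm. A closed subspace $X$ of a Banach space $B$ is complemented in $B$ if there exists a continuous (linear) projection from $B$ onto $X$. *)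

(* Defs.v *)
From HB Require Import structures.
From mathcomp Require Import all_boot all_order all_algebra.
From mathcomp Require Import all_classical all_reals all_analysis.

Set Implicit Arguments.
Unset Strict Implicit.
Unset Printing Implicit Defensive.

Import Order.TTheory GRing.Theory Num.Theory.
Import numFieldNormedType.Exports.

Local Open Scope classical_set_scope.
Local Open Scope ring_scope.

Definition Fin : set (set nat) := [set A | finite_set A].

Record ideal := Ideal {
  ideal_sets : set (set nat);
  ideal_subset : forall A B, A `<=` B -> ideal_sets B -> ideal_sets A;
  ideal_setU : forall A B,
    ideal_sets A -> ideal_sets B -> ideal_sets (A `|` B);
  ideal_Fin : Fin `<=` ideal_sets;
  ideal_proper : ~ ideal_sets [set: nat] }.

Section SequenceSpaces.
Context {R : realType}.

Definition ideal_cvg (I : ideal) (x : nat -> R) (y : R) : Prop :=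
  forall U, nbhs y U -> ideal_sets I [set n | ~ U (x n)].

Definition c_ideal (I : ideal) : set (nat -> R) :=
  [set x | exists y, ideal_cvg I x y].

Definition c_seq : set (nat -> R) := [set x | cvgn x].

Definition linfty : set (nat -> R) := [set x | bounded_fun x].

Definition sup_norm (x : nat -> R) : R := sup (range (fun n => `|x n|)).

End SequenceSpaces.

Definition dual_filter (I : ideal) : set_system nat := [set A | ideal_sets I (~` A)].

#[global] Instance dual_filter_proper (I : ideal) :
  ProperFilter (dual_filter I).
Proof.
split; first by rewrite /dual_filter /= setC0; exact: ideal_proper.
split=> [|A B IA IB|A B AB].
- by rewrite /dual_filter /= setCT; apply: ideal_Fin; exact: finite_set0.
- by rewrite /dual_filter /= setCI; exact: ideal_setU.
- by apply: ideal_subset => n nB /AB.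
Qed.

Section SequenceSpacesTheory.
Context {R : realType}.
Implicit Types (I : ideal) (x : nat -> R).

Lemma c_idealP I x : c_ideal I x <-> cvg (x @ dual_filter I).
Proof.
split=> [[y xy]|/cvg_ex[/= y xy]]; last by exists y.
by apply/cvg_ex; exists y.
Qed.

Lemma linftyP x : linfty x <-> exists M, forall n, `|x n| <= M.
Proof.
split=> [|[M xM]].
  by move=> /pinfty_ex_gt0[M _ xM]; exists M => n; exact: xM.
by exists M; split; [exact: num_real | move=> N /ltW MN n _; exact: le_trans MN].
Qed.

Lemma sup_norm_ub x : linfty x -> forall n, `|x n| <= sup_norm x.
Proof.
move=> /linftyP[M xM] n; apply: ub_le_sup; last by exists n.
by exists M => _ [k _ <-].
Qed.

Lemma sup_norm_le x M : (forall n, `|x n| <= M) -> sup_norm x <= M.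
Proof.
by move=> xM; apply: ge_sup; [exists `|x 0%N|, 0%N | move=> _ [k _ <-]].
Qed.

Lemma c_seq_sub I : @c_seq R `<=` c_ideal I `&` linfty.
Proof.
move=> x xc; split; last first.
  apply/linftyP; have /pinfty_ex_gt0[M _ xM] := cvg_seq_bounded xc.
  by exists M => n; exact: xM.
have /cvg_ex[/= y xy] := xc; exists y => U /xy [N _ NU].
apply: ideal_Fin; apply: (@sub_finite_set _ _ `I_N); last exact: finite_II.
by move=> n nU /=; rewrite ltnNge; apply/negP => /NU.
Qed.

End SequenceSpacesTheory.

(* The subtype below is a copy of [c_ideal I `&` linfty], so that it carries
   the sup norm and not the product topology of [nat -> R]. *)
Section BoundedIdealConvergent.
Context (R : realType) (I : ideal).

Definition c_linfty_pred : {pred nat -> R} :=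
  mem (c_ideal I `&` linfty : set (nat -> R)).

Lemma c_linfty_submod_closed : submod_closed c_linfty_pred.
Proof.
split.
  by rewrite inE; apply: c_seq_sub; exact: is_cvg_cst.
move=> a x y; rewrite !inE => -[/c_idealP xc /linftyP[M xM]].
move=> [/c_idealP yc /linftyP[N yN]]; split.
  by apply/c_idealP; apply: is_cvgD => //; exact: is_cvgZr.
apply/linftyP; exists (`|a| * M + N) => n.
by rewrite (le_trans (ler_normD _ _))// lerD// normrM ler_wpM2l.
Qed.

HB.instance Definition _ :=
  GRing.isSubmodClosed.Build R (nat -> R) c_linfty_pred c_linfty_submod_closed.

Record c_linfty := CLinfty {
  c_linfty_val :> nat -> R;
  c_linfty_valP : c_linfty_val \in c_linfty_pred }.

HB.instance Definition _ := [isSub for c_linfty_val].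
HB.instance Definition _ := [Choice of c_linfty by <:].
HB.instance Definition _ := [SubChoice_isSubLmodule of c_linfty by <:].

Definition c_linfty_norm (x : c_linfty) : R := sup_norm x.

Lemma c_linfty_bounded (x : c_linfty) : linfty x.
Proof. by have := c_linfty_valP x; rewrite inE => -[]. Qed.

Lemma c_linfty_ler_normD (x y : c_linfty) :
  c_linfty_norm (x + y) <= c_linfty_norm x + c_linfty_norm y.
Proof.
apply: sup_norm_le => n; rewrite (le_trans (ler_normD _ _))//.
by apply: lerD; apply: sup_norm_ub; exact: c_linfty_bounded.
Qed.

Lemma c_linfty_normrZ (a : R) (x : c_linfty) :
  c_linfty_norm (a *: x) = `|a| * c_linfty_norm x.
Proof.
apply/eqP; rewrite eq_le; apply/andP; split.
  apply: sup_norm_le => n; rewrite normrM ler_wpM2l//.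
  by apply: sup_norm_ub; exact: c_linfty_bounded.
have [->|a0] := eqVneq a 0.
  rewrite normr0 mul0r (le_trans (normr_ge0 ((0 *: x : c_linfty) 0%N)))//.
  by apply: sup_norm_ub; exact: c_linfty_bounded.
rewrite mulrC -ler_pdivlMr ?normr_gt0//.
apply: sup_norm_le => n; rewrite ler_pdivlMr ?normr_gt0// mulrC -normrM.
exact: (sup_norm_ub (c_linfty_bounded (a *: x))).
Qed.

Lemma c_linfty_normr0_eq0 (x : c_linfty) : c_linfty_norm x = 0 -> x = 0.
Proof.
move=> x0; apply/val_inj/funext => n /=; apply/eqP.
rewrite -normr_le0 -x0.
by apply: sup_norm_ub; exact: c_linfty_bounded.
Qed.

HB.instance Definition _ := Lmodule_isNormed.Build R c_linfty
  c_linfty_ler_normD c_linfty_normrZ c_linfty_normr0_eq0.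

Lemma c_linfty_normE (x : c_linfty) : `|x| = sup_norm x.
Proof. by []. Qed.

Lemma c_linfty_norm_ub (x : c_linfty) n : `|x n| <= `|x|.
Proof. by apply: sup_norm_ub; exact: c_linfty_bounded. Qed.

Lemma c_linfty_complete (F : set_system c_linfty) :
  ProperFilter F -> cauchy F -> cvg F.
Proof.
move=> FF /cauchy_ballP Fc.
have Fn n : cvg ((b : c_linfty) n @[b --> F]).
  apply/cauchy_cvgP/cauchy_exP => e e0.
  have /cauchyP/(_ _ e0)[b Fb] : cauchy F by apply/cauchy_ballP.
  exists (b n); change (F [set d : c_linfty | ball (b n) e (d n)]).
  apply: filterS Fb => d /=; rewrite -!ball_normE /= => bd.
  exact: le_lt_trans (c_linfty_norm_ub (b - d) n) bd.
pose x n : R := lim ((b : c_linfty) n @[b --> F]).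
have Fx e : 0 < e -> \forall b \near F, forall n, `|(b : c_linfty) n - x n| <= e.
  move=> e0; have := Fc _ e0; rewrite near_simpl => /nearP_dep Fe.
  apply: filterS Fe => b Fb n.
  have bx : `|(b : c_linfty) n - (d : c_linfty) n| @[d --> F]
      --> `|(b : c_linfty) n - x n|.
    by apply: cvg_norm; apply: cvgB; [exact: cvg_cst | exact: Fn].
  apply: (closed_cvg (fun r : R => r <= e)) bx; first exact: closed_le.
  apply: filterS Fb => d; rewrite -ball_normE /= => bd.
  exact: ltW (le_lt_trans (c_linfty_norm_ub (b - d) n) bd).
have xP : x \in c_linfty_pred.
  rewrite inE; split.
    apply/c_idealP/cauchy_cvgP/cauchy_exP => e e0.
    have e20 : 0 < e / 2 by rewrite divr_gt0.
    have [b bx] := filter_ex (Fx _ e20).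
    have := c_linfty_valP b; rewrite inE => -[[y by_] _].
    exists y; change (dual_filter I [set n | ball y e (x n)]).
    have : dual_filter I [set n | ball y (e / 2) (b n)].
      exact: by_ (nbhsx_ballx y _ e20).
    apply: filterS => n /=.
    rewrite -!ball_normE /= => ybn.
    rewrite -[y - _](subrKA (b n)) (splitr e).
    by rewrite (le_lt_trans (ler_normD _ _))// ltr_leD.
  have [b bx] := filter_ex (Fx _ ltr01).
  apply/linftyP; exists (`|b| + 1) => n.
  rewrite -(subKr (b n) (x n)) (le_trans (ler_normB _ _))//.
  by rewrite lerD// c_linfty_norm_ub.
apply/cvg_ex; exists (CLinfty xP); apply/cvgrPdist_le => e e0.
apply: filterS (Fx _ e0) => b bx; rewrite distrC.
exact: sup_norm_le.
Qed.

HB.instance Definition _ := Uniform_isComplete.Build c_linfty c_linfty_complete.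

(* By [c_seq_sub] every convergent sequence lies in the ambient space. *)
Definition c_in_c_linfty : set c_linfty := [set x | c_seq (x : nat -> R)].

Lemma c_in_c_linfty_closed : closed c_in_c_linfty.
Proof.
move=> x clx; apply/cauchy_cvgP/cauchy_exP => e e0.
have e20 : 0 < e / 2 by rewrite divr_gt0.
have [b [/cvg_ex[/= y bly]]] := clx _ (nbhsx_ballx x _ e20).
rewrite -ball_normE /= => xb; exists y.
have : \forall n \near \oo, ball y (e / 2) (b n).
  exact: bly (nbhsx_ballx y _ e20).
change (nbhs \oo [set n | ball y (e / 2) (b n)] ->
  nbhs \oo [set n | ball y e (x n)]).
apply: filterS => n /=; rewrite -!ball_normE /= => ybn.
rewrite -[y - _](subrKA (b n)) (splitr e).
rewrite (le_lt_trans (ler_normD _ _))// ltrD// distrC.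
exact: le_lt_trans (c_linfty_norm_ub (x - b) n) xb.
Qed.

Lemma c_in_c_linfty_linear (a : R) (x y : c_linfty) :
  c_in_c_linfty x -> c_in_c_linfty y -> c_in_c_linfty (a *: x + y).
Proof. by move=> xc yc; apply: is_cvgD => //; exact: is_cvgZr. Qed.

End BoundedIdealConvergent.

Arguments c_in_c_linfty : clear implicits.

(* Meant for [X] a closed linear subspace; the range of a continuous linear
   projection is always one. *)
Definition complemented {R : realType} {B : completeNormedModType R}
    (X : set B) : Prop :=
  exists P : {linear B -> B},
    [/\ continuous P, range P = X & forall x, X x -> P x = x].

(* Main.v *)
Require Import Defs.
From HB Require Import structures.
From mathcomp Require Import all_boot all_order all_algebra.
From mathcomp Require Import all_classical all_reals all_analysis.
Set Implicit Arguments.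
Unset Strict Implicit.
Unset Printing Implicit Defensive.

Import Order.TTheory GRing.Theory Num.Theory.
Import numFieldNormedType.Exports.

Local Open Scope classical_set_scope.
Local Open Scope ring_scope.

(** If the ideal is [Fin], the ambient space is [c] and the identity is a
projection. The converse adapts Whitley's proof of the theorem of Phillips and
Sobczyk that [c_0] is not complemented in [l_oo].

Suppose that the ideal contains an infinite set [A] and let [P] be a bounded
projection onto [c]. Each functional [Phi_n x := (x - P x) n] is bounded and
kills [c]; in particular it ignores finitely many coordinates, so [|Phi_n x|]
is controlled by the values of [x] near infinity only
([functional_near_le]). Take an uncountable family of infinite, pairwise almost
disjoint subsets of [A]. All of them belong to the ideal, hence their
indicators lie in the ambient space. Any combination of these indicators
with coefficients in [[-1, 1]] is, up to finitely many coordinates, bounded by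
1. Choosing the signs of the coefficients well, the sum of the values
[|Phi_n 1_B|] over any finite subfamily is at most a constant
([functional_sum_le]), and so [Phi_n 1_B <> 0] for only countably many members
[B] of the family ([functional_countable_support]). As there are countably many
functionals [Phi_n], some member [B] has [Phi_n 1_B = 0] for all [n], that is,
[1_B = P 1_B] converges. But [B] is infinite, and so is its complement since
the ideal is proper: a contradiction. *)

(** * Finite and countable sets *)

Lemma finite_setP_near (D : set nat) :
  finite_set D <-> \forall n \near \oo, ~ D n.
Proof.
split=> [/finite_seqP[X ->]|[N _ ND]].
  exists (\max_(i <- X) i).+1%N => // n /= Xn nX.
  by move: Xn; rewrite ltnNge leq_bigmax_seq.
apply: (@sub_finite_set _ _ `I_N); last exact: finite_II.
by move=> n Dn /=; rewrite ltnNge; apply/negP => /ND; exact.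
Qed.

Lemma infinite_set_near_ex (D P : set nat) :
  infinite_set D -> (\forall n \near \oo, P n) -> exists2 n, D n & P n.
Proof.
move=> infD nP; apply: contrapT => noDP; apply: infD.
apply/finite_setP_near; apply: filterS nP => n Pn Dn.
by apply: noDP; exists n.
Qed.

(** Cantor's diagonal argument: if [h] is injective, [d] differs at [h f] from
every [f], itself included. *)
Lemma uncountable_cantor : ~ countable [set: nat -> bool].
Proof.
move=> /countable_injP[h hinj].
pose d n := `[< exists2 f : nat -> bool, h f = n & ~~ f n >].
have [dh|/negP dh] := boolP (d (h d)).
  have /asboolP[f hfd] := dh.
  have -> : f = d by apply: hinj => //; rewrite inE.
  by rewrite dh.
by apply: (dh); apply/asboolP; exists d => //; apply/negP.
Qed.

(** * An uncountable almost disjoint family *)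

(** The set of nodes on a branch of the binary tree, where the node reached by
the word [w] is labelled with [e (pickle w)]. Two branches share only the nodes
above the point where they split. *)
Definition branch (e : nat -> nat) (f : nat -> bool) : set nat :=
  range (fun n => e (pickle (mkseq f n))).

Section Branches.
Variables (e : nat -> nat) (inj_e : injective e).

Lemma branch_node_inj (f g : nat -> bool) m n :
  e (pickle (mkseq f m)) = e (pickle (mkseq g n)) ->
  m = n /\ forall i, (i < n)%N -> f i = g i.
Proof.
move=> /inj_e /(pcan_inj pickleK) fg.
have mn : m = n by have := congr1 size fg; rewrite !size_mkseq.
split=> // i i_n; have := congr1 (nth false ^~ i) fg.
by rewrite /= !nth_mkseq // mn.
Qed.

Lemma infinite_branch f : infinite_set (branch e f).
Proof.
have inj_f : {in [set: nat] &, injective (fun n => e (pickle (mkseq f n)))}.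
  by move=> m n _ _ /branch_node_inj[].
by rewrite (eq_finite_set (inj_card_eq inj_f)); exact: infinite_nat.
Qed.

Lemma finite_branchI f g : f <> g -> finite_set (branch e f `&` branch e g).
Proof.
move=> fg; have [d fgd] : exists d, f d <> g d.
  by apply: contrapT => /forallNP fgE; apply: fg; apply/funext => d;
    apply: contrapT; exact: fgE.
apply: (@sub_finite_set _ _ [set e (pickle (mkseq f n)) | n in `I_d.+1]).
  move=> _ [[m _ <-] [n _ nm]]; exists m => //=.
  have [nmE gf] := branch_node_inj nm.
  by rewrite ltnS leqNgt; apply/negP => /gf /esym.
by apply: finite_image; exact: finite_II.
Qed.

End Branches.

(** * Almost disjoint sequences and functionals that kill [c] *)

Section Sequences.
Context {R : realType}.
Implicit Types D : set nat.

Lemma indic_not_cvg D : infinite_set D -> infinite_set (~` D) ->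
  ~ @c_seq R (\1_D).
Proof.
move=> infD infDC /cvg_ex[/= l /cvgrPdist_lt /(_ 2^-1)].
rewrite invr_gt0 ltr0n => /(_ isT) near_l.
have [m Dm ml] := infinite_set_near_ex infD near_l.
have [n Dn nl] := infinite_set_near_ex infDC near_l.
move: ml nl; rewrite !indicE mem_set// memNset//= => ml nl.
have : `|1 - 0 : R| < 1.
  rewrite (le_lt_trans (ler_distD l _ _))// [ltRHS]splitr ltrD ?div1r//.
  by rewrite distrC.
by rewrite subr0 normr1 ltxx.
Qed.

(** Far enough, at most one of the finitely many sequences is nonzero at each
index, so that the sum is bounded like a single term. *)
Lemma near_sum_le1 (T : eqType) (b : T -> nat -> R) (s : seq T) :
  (forall t n, `|b t n| <= 1) ->
  (forall t u, t <> u -> \forall n \near \oo, b t n = 0 \/ b u n = 0) ->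
  uniq s -> \forall n \near \oo, `|\sum_(t <- s) b t n| <= 1.
Proof.
move=> b1 b0; elim: s => [_|t s IHs /= /andP[ts us]].
  by near=> n; rewrite big_nil normr0.
have : \forall n \near \oo, {in s, forall u, b t n = 0 \/ b u n = 0}.
  elim: s ts {IHs us} => [_|u s IHs]; first by near=> n => ?.
  rewrite inE negb_or => /andP[/eqP tu ts].
  apply: filterS2 (b0 _ _ tu) (IHs ts) => n btu bts v.
  by rewrite inE => /predU1P[->|/bts].
apply: filterS2 (IHs us) => n sn bn; rewrite big_cons.
have [->|btn] := eqVneq (b t n) 0; first by rewrite add0r.
rewrite big1_seq ?addr0// => u /= us'.
by have [bt0|//] := bn u us'; rewrite bt0 eqxx in btn.
Unshelve. all: by end_near. Qed.

Variable I : ideal.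
Local Notation E := (c_linfty R I).

(** The coordinate is named so that it can carry its linear structure, which
makes [coord n \o (idfun \- P)] a linear functional. *)
Definition coord (n : nat) (x : E) : R := x n.

Lemma coord_is_linear n : scalar (coord n).
Proof. by []. Qed.

HB.instance Definition _ n :=
  GRing.isLinear.Build R E R _ (coord n) (coord_is_linear n).

Section FunctionalsKillingC.
Variables (Phi : {scalar E}) (M : R).
Hypothesis M_ge0 : 0 <= M.
Hypothesis PhiM : forall x, `|Phi x| <= M * `|x|.
Hypothesis Phic : forall x, c_in_c_linfty R I x -> Phi x = 0.

(** Subtracting from [x] its truncation, which is eventually zero and thus
convergent, brings the norm to at most 1 without changing the value of [Phi]. *)
Lemma functional_near_le (x : E) :
  (\forall n \near \oo, `|x n| <= 1) -> `|Phi x| <= M.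
Proof.
move=> [N _ Nx].
pose y n : R := if (n < N)%N then x n else 0.
have yc : c_seq y.
  apply/cvg_ex; exists 0; apply: cvg_near_cst.
  by exists N => // n /= Nn; rewrite /y ltnNge Nn.
have yE : y \in c_linfty_pred I by rewrite inE; exact: c_seq_sub.
have -> : Phi x = Phi (x - CLinfty yE).
  by rewrite raddfB /= [Phi (CLinfty _)]Phic ?subr0.
rewrite (le_trans (PhiM _))// ler_piMr//; apply: sup_norm_le => n.
change (`|x n - y n| <= 1); rewrite /y; case: ltnP => [_|Nn].
  by rewrite subrr normr0.
by rewrite subr0; exact: Nx.
Qed.

(** The left-hand side is the value of [Phi] at the combination of the [b t] with
coefficients the signs of [Phi (b t)]; near infinity this combination is
bounded by 1. *)
Lemma functional_sum_le (T : eqType) (b : T -> E) (s : seq T) :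
  (forall t n, `|b t n| <= 1) ->
  (forall t u, t <> u -> \forall n \near \oo, b t n = 0 \/ b u n = 0) ->
  uniq s -> \sum_(t <- s) `|Phi (b t)| <= M.
Proof.
move=> b1 b0 us.
pose x : E := \sum_(t <- s) Num.sg (Phi (b t)) *: b t.
have -> : \sum_(t <- s) `|Phi (b t)| = Phi x.
  by rewrite linear_sum; apply: eq_bigr => t _; rewrite linearZ /= normrEsg.
rewrite (le_trans (ler_norm _))//; apply: functional_near_le.
have xE n : x n = \sum_(t <- s) Num.sg (Phi (b t)) * b t n.
  rewrite -[LHS]/(coord n x) linear_sum; apply: eq_bigr => t _.
  by rewrite linearZ.
under eq_near do rewrite xE.
apply: (near_sum_le1 _ _ us) => [t n|t u /b0].
  rewrite normrM normr_sg; case: (_ != 0); first by rewrite mul1r.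
  by rewrite mul0r ler01.
by apply: filterS => n [->|->]; rewrite mulr0; [left|right].
Qed.

(** By [functional_sum_le], at most [M * k.+1] indices satisfy
[|Phi (b t)| > 1 / k.+1]; the support is the union over [k] of these
finite sets. *)
Lemma functional_countable_support (T : choiceType) (b : T -> E) :
  (forall t n, `|b t n| <= 1) ->
  (forall t u, t <> u -> \forall n \near \oo, b t n = 0 \/ b u n = 0) ->
  countable [set t | Phi (b t) != 0].
Proof.
move=> b1 b0; pose large k := [set t | k.+1%:R^-1 < `|Phi (b t)|].
apply: (@sub_countable _ _ _ (\bigcup_k large k)).
  apply: subset_card_le => t /= Phit0.
  have [|k] := @ltr_add_invr R 0 `|Phi (b t)|; first by rewrite normr_gt0.
  by rewrite add0r => tk; exists k.
apply: bigcup_countable => // k _; apply: finite_set_countable.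
apply: contrapT => /(infinite_set_fset (Num.truncn (M * k.+1%:R)).+1)[B Bk Bn].
have := functional_sum_le b1 b0 (finmap.fset_uniq B); apply/negP; rewrite -ltNge.
apply: (@lt_le_trans _ _ (\sum_(t <- finmap.enum_fset B) (k.+1%:R^-1 : R))).
  rewrite big_const_seq count_predT iter_addr_0 -[ltRHS]mulr_natl.
  rewrite ltr_pdivlMr ?ltr0n// (lt_le_trans (truncnS_gt _))//.
  by rewrite ler_nat.
by rewrite big_seq [leRHS]big_seq; apply: ler_sum => t /Bk /ltW.
Qed.

End FunctionalsKillingC.

(** * The range of a projection onto [c] *)

(** The indicator of a set of the ideal converges to 0 along the ideal. *)
Lemma indic_c_linfty D : ideal_sets I D -> (\1_D : nat -> R) \in c_linfty_pred I.
Proof.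
move=> ID; rewrite inE; split.
  exists 0 => U /nbhs_singleton U0; apply: ideal_subset ID => n /= Un.
  by apply: contrapT => Dn; apply: Un; rewrite indicE memNset.
by apply/linftyP; exists 1 => n; rewrite indicE normr_nat lern1 leq_b1.
Qed.

(** The branches, transported into an infinite set of the ideal by [e], index too
many indicators for the countably many functionals [Phi n] to detect all of
them; an undetected indicator is fixed by [P], hence convergent. *)
Lemma complemented_Fin :
  complemented (c_in_c_linfty R I) -> ideal_sets I `<=` Fin.
Proof.
move=> [P [Pcont Prange Pid]] A IA; apply: contrapT => /= infA.
have [e inj_e eA] : exists2 e : nat -> nat, injective e & range e `<=` A.
  have /infiniteP/pcard_leP[e] := infA.
  by exists e; [move=> m n; apply: inj; rewrite inE | move=> _ [n _ <-]; exact: funS].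
have [M M0 PM] : exists2 M, 0 < M & forall x, `|P x| <= M * `|x|.
  apply/pinfty_ex_gt0/linear_boundedP/continuous_linear_bounded.
  exact: Pcont.
pose Phi n : {scalar E} := coord n \o (idfun \- P).
have PhiM n x : `|Phi n x| <= (1 + M) * `|x|.
  rewrite (le_trans (c_linfty_norm_ub (x - P x) n))//.
  by rewrite (le_trans (ler_normB _ _))// mulrDl mul1r lerD2l.
have Phic n x : c_in_c_linfty R I x -> Phi n x = 0.
  by move=> /Pid Px; rewrite /Phi /= Px subrr.
have Ibranch f : ideal_sets I (branch e f).
  apply: ideal_subset IA => _ [n _ <-]; exact: eA.
pose b f : E := CLinfty (indic_c_linfty (Ibranch f)).
have b1 f n : `|b f n| <= 1.
  by rewrite /b /= indicE normr_nat lern1 leq_b1.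
have b0 f g : f <> g -> \forall n \near \oo, b f n = 0 \/ b g n = 0.
  move=> /(finite_branchI inj_e)/finite_setP_near; apply: filterS => n fgn.
  rewrite /b /= !indicE.
  have [nf|nf] := pselect (branch e f n); last by left; rewrite memNset.
  by right; rewrite memNset// => ng; exact: fgn.
apply: uncountable_cantor.
apply: (@sub_countable _ _ _ (\bigcup_n [set f | Phi n (b f) != 0])).
  apply: subset_card_le => f _; apply: contrapT => Phi0.
  (* A set of the ideal with a finite complement would put the whole of [nat]
     in the ideal. *)
  have infC : infinite_set (~` branch e f).
    move=> finC; apply: (@ideal_proper I).
    rewrite -(setUv (branch e f)); apply: ideal_setU => //.
    exact: ideal_Fin.
  apply: (indic_not_cvg (infinite_branch inj_e (f := f)) infC).
  suff -> : \1_(branch e f) = P (b f) :> (nat -> R).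
    have : range P (P (b f)) by exists (b f).
    by rewrite Prange.
  apply/funext => n; apply/eqP; rewrite -subr_eq0.
  by apply: contrapT => /negP Phin; apply: Phi0; exists n.
apply: bigcup_countable => // n _.
by apply: (functional_countable_support _ (PhiM n) (Phic n) b1 b0); rewrite addr_ge0// ltW.
Qed.

Lemma c_in_c_linfty_FinE : ideal_sets I `<=` Fin ->
  c_in_c_linfty R I = [set: E].
Proof.
move=> IFin; apply/seteqP; split=> // x _.
have := c_linfty_valP x; rewrite inE => -[[y xy] _].
apply/cvg_ex; exists y => U /xy /IFin /finite_setP_near.
by apply: filterS => n /contrapT.
Qed.

End Sequences.

Theorem corollary1p5 (R : realType) (I : ideal) :
  complemented (c_in_c_linfty R I) <-> ideal_sets I = Fin.
Proof.
split=> [/complemented_Fin IFin|IFin].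
  by apply/seteqP; split=> //; exact: ideal_Fin.
rewrite c_in_c_linfty_FinE ?IFin//.
exists idfun; split=> //; first by move=> x; exact: cvg_id.
by rewrite image_id.
Qed.
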